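(* Let $G$ be a connected finite simple graph with $n$ vertices, without isolated vertices, and with vertex bipartiteness $\upsilon_b(G)$. Then $$s_Q(G)\ \ge\ \mu_1(G)-\upsilon_b(G).$$ Moreover, if $G$ is a connected bipartite graph, then equality holds.
   Context: For a finite simple graph $G$ on $n$ vertices, let $A_G$ be its adjacency matrix and $D_G$ the diagonal matrix of vertex degrees. The signless Laplacian matrix is $Q_G=D_G+A_G$ with eigenvalues $q_1\ge q_2\ge\cdots\ge q_n$, and the signless Laplacian spread is $s_Q(G)=q_1-q_n$. The Laplacian matrix is $L_G=D_G-A_G$, and $\mu_1(G)$ denotes its largest eigenvalue. The vertex bipartiteness $\upsilon_b(G)$ is the minimum number of vertices of $G$ whose deletion yields a bipartite graph (so $\upsilon_b(G)=0$ if $G$ is bipartite). *)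

(* Defs.v *)
From HB Require Import structures.
From mathcomp Require Import all_boot all_order all_algebra.
From mathcomp Require Import polyrcf.

Set Implicit Arguments.
Unset Strict Implicit.
Unset Printing Implicit Defensive.

Import Order.TTheory GRing.Theory Num.Theory.

Local Open Scope ring_scope.

Record sgraph (T : finType) := SGraph {
  adj :> rel T;
  adj_sym : symmetric adj;
  adj_irr : irreflexive adj
}.

Section Graphs.
Variables (T : finType) (G : sgraph T).

Definition connected_graph : bool :=
  (0 < #|T|)%N && [forall x, forall y, connect G x y].

Definition no_isolated_vertex : bool := [forall x, exists y, G x y].

(* X and its complement are the two (possibly empty) colour classes. *)
Definition bipartite : bool :=
  [exists X : {set T}, forall x, forall y, G x y ==> ((x \in X) != (y \in X))].

Definition degree (x : T) : nat := #|[set y | G x y]|.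

Variable S : {set T}.

Let V := {x : T | x \notin S}.

Let del_adj : rel V := relpre val G.

Fact del_adj_sym : symmetric del_adj.
Proof. by move=> x y; apply: adj_sym. Qed.

Fact del_adj_irr : irreflexive del_adj.
Proof. by move=> x; apply: adj_irr. Qed.

Definition del_vertices : sgraph V := SGraph del_adj_sym del_adj_irr.

End Graphs.

Fact bipartite_del_setT (T : finType) (G : sgraph T) :
  bipartite (del_vertices G [set: T]).
Proof.
by apply/existsP; exists set0; apply/forallP => -[x xP]; have:= xP; rewrite inE.
Qed.

(* The default set [set: T] satisfies the condition, by bipartite_del_setT, so
   this is the true minimum. *)
Definition vertex_bipartiteness (T : finType) (G : sgraph T) : nat :=
  #|[arg min_(S < [set: T] | bipartite (del_vertices G S)) #|S| ]|.

Section Spectra.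
Variable R : rcfType.

(* The roots in R of the characteristic polynomial, in nonincreasing order and
   repeated according to multiplicity.  For symmetric A, these are all n
   eigenvalues of A. *)
Definition eigenvalues n (A : 'M[R]_n) : seq R :=
  let p := char_poly A in
  rev (flatten [seq nseq (mup x p) x | x <- rootsR p]).

Lemma mem_eigenvalues n (A : 'M[R]_n) x :
  (x \in eigenvalues A) = eigenvalue A x.
Proof.
have p0 : char_poly A != 0 by rewrite monic_neq0 ?char_poly_monic.
have rE : (x \in rootsR (char_poly A)) = root (char_poly A) x.
  by rewrite -(roots_on_rootsR p0) in_itv.
rewrite eigenvalue_root_char mem_rev; apply/flatten_mapP/idP => [[y yr]|xr].
  by rewrite mem_nseq => /andP[_ /eqP->]; rewrite -(roots_on_rootsR p0) in yr.
exists x; first by rewrite rE.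
by rewrite mem_nseq eqxx andbT -XsubC_dvd // dvdp_XsubCl.
Qed.

Definition max_eigenvalue n (A : 'M[R]_n) : R := head 0 (eigenvalues A).
Definition min_eigenvalue n (A : 'M[R]_n) : R := last 0 (eigenvalues A).

Variables (n : nat) (G : sgraph 'I_n).

Definition adjacency_mx : 'M[R]_n := \matrix_(i, j) (G i j)%:R.

Definition degree_mx : 'M[R]_n := diag_mx (\row_i (degree G i)%:R).

Definition signless_laplacian : 'M[R]_n := degree_mx + adjacency_mx.

Definition laplacian : 'M[R]_n := degree_mx - adjacency_mx.

Definition signless_spread : R :=
  max_eigenvalue signless_laplacian - min_eigenvalue signless_laplacian.

Definition laplacian_radius : R := max_eigenvalue laplacian.

End Spectra.

(* Main.v *)
Require Import Defs.
From mathcomp Require Import all_boot all_order all_algebra.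
From mathcomp Require Import polyrcf complex.
From mathcomp Require Import ring.
Import Order.TTheory GRing.Theory Num.Theory.
Local Open Scope ring_scope.
Local Open Scope sesquilinear_scope.
Local Open Scope complex_scope.

Set Implicit Arguments.
Unset Strict Implicit.
Unset Printing Implicit Defensive.

(* By Rayleigh's principle it suffices to compare quadratic forms, and
   u (D + e A) u^T is the sum over the edges ij of (u_i + e u_j)^2 for e = 1, -1.
   Replacing u by |u| increases this form from e = -1 to e = 1, so mu_1 <= q_1.
   If S is a set of vertices whose deletion leaves a bipartite graph, the vector
   equal to 0 on S and to 1, -1 on the two colour classes has squared norm
   n - #|S|, and only edges leaving S contribute to its form, so q_n <= #|S|.
   For bipartite G, flipping the signs on one colour class exchanges the two
   forms, so q_1 = mu_1, and 0 <= q_n <= 0. *)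

(** * Extremal eigenvalues of symmetric matrices and Rayleigh's principle *)

Section ExtremalEigenvalues.
Variables (R : rcfType) (n : nat).
Implicit Types (A B : 'M[R]_n) (u v : 'rV[R]_n).

(** [pairwise] splits over concatenation, which makes the induction on the list of distinct roots
    direct. *)
Lemma pairwise_flatten_nseq (f : R -> nat) (s : seq R) :
  sorted <%R s -> pairwise <=%R (flatten [seq nseq (f x) x | x <- s]).
Proof.
rewrite (sorted_pairwise lt_trans); elim: s => //= x s IHs /andP[ltx /IHs s_le].
rewrite pairwise_cat s_le andbT; apply/andP; split.
  apply/allrelP => y z /[!mem_nseq]/andP[_ /eqP->] /flatten_mapP[t ts].
  by rewrite mem_nseq => /andP[_ /eqP->]; apply/ltW/(allP ltx).
elim: (f x) => //= k ->; rewrite andbT.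
by apply/allP => y /[!mem_nseq]/andP[_ /eqP->].
Qed.

Lemma eigenvalues_sorted A : sorted >=%R (eigenvalues A).
Proof.
by rewrite rev_sorted (sorted_pairwise le_trans) pairwise_flatten_nseq ?sorted_roots.
Qed.

Lemma le_max_eigenvalue A a : eigenvalue A a -> a <= max_eigenvalue A.
Proof.
rewrite -mem_eigenvalues /max_eigenvalue; have := eigenvalues_sorted A.
case: eigenvalues => //= b s /(order_path_min ge_trans)/allP b_max.
by rewrite inE => /predU1P[->|/b_max].
Qed.

Lemma ge_min_eigenvalue A a : eigenvalue A a -> min_eigenvalue A <= a.
Proof.
rewrite -mem_eigenvalues /min_eigenvalue; have := eigenvalues_sorted A.
case/lastP: (eigenvalues A) => // s b; rewrite last_rcons.
rewrite -rev_sorted rev_rcons /= => /(order_path_min le_trans)/allP b_min.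
by rewrite mem_rcons inE -mem_rev => /predU1P[->|/b_min].
Qed.

(** The given eigenvalue makes the list nonempty, so [head] does not fall back on its default 0. *)
Lemma eigenvalue_max A a : eigenvalue A a -> eigenvalue A (max_eigenvalue A).
Proof.
rewrite -!mem_eigenvalues /max_eigenvalue.
by case: eigenvalues => //= b s _; apply: mem_head.
Qed.

Lemma eigenvalue_min A a : eigenvalue A a -> eigenvalue A (min_eigenvalue A).
Proof.
rewrite -!mem_eigenvalues /min_eigenvalue.
by case: eigenvalues => //= b s _; apply: mem_last.
Qed.

Definition quad_form A u : R := (u *m A *m u^T) 0 0.
Definition sqr_norm u : R := \sum_i u 0 i ^+ 2.

Lemma sqr_norm_gt0 u : u != 0 -> 0 < sqr_norm u.
Proof.
move=> u0; rewrite lt_def sumr_ge0 ?andbT => [|i _]; last exact: sqr_ge0.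
apply: contra_neq u0 => /eqP.
rewrite psumr_eq0 => [/allP u0|i _]; last exact: sqr_ge0.
apply/rowP => i; rewrite mxE; apply/eqP; rewrite -sqrf_eq0.
exact: (implyP (u0 i (mem_index_enum i))).
Qed.

Lemma quad_formE A u : quad_form A u = \sum_i \sum_j A i j * (u 0 i * u 0 j).
Proof.
rewrite /quad_form mxE exchange_big; apply: eq_bigr => j _.
by rewrite mxE mulr_suml; apply: eq_bigr => i _; rewrite mxE; ring.
Qed.

Lemma quad_form_eigen A u a :
  u *m A = a *: u -> quad_form A u = a * sqr_norm u.
Proof.
by move=> uA; rewrite /quad_form uA -scalemxAl mxE mxE; under eq_bigr do rewrite mxE.
Qed.

(* The d i are the spectrum of A over R[i], which is real, and w i is the squared
   modulus of the i-th coordinate y i of u in a unitary eigenbasis. *)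
Lemma quad_form_spectral A u : A^T = A -> exists d w : 'I_n -> R,
  [/\ forall i, eigenvalue A (d i), forall i, 0 <= w i,
      sqr_norm u = \sum_i w i & quad_form A u = \sum_i d i * w i].
Proof.
move=> A_sym; pose toC : {rmorphism R -> R[i]} := real_complex R.
pose AC := map_mx toC A.
have AC_herm : AC \is hermsymmx.
  apply: realsym_hermsym; last first.
    by apply/mxOverP => i j; rewrite mxE; apply/complex_realP; exists (A i j).
  by apply/is_hermitianmxP; rewrite scale1r map_mx_id // map_trmx A_sym.
have AC_spec := orthomx_spectralP (hermitian_normalmx AC_herm).
have := hermitian_spectral_diag_real AC_herm.
have := spectral_unit AC; have := spectral_unitarymx AC.
move: AC_spec; set P := spectralmx AC; set D := spectral_diag AC.
move=> AC_spec P_unitary P_unit /mxOverP D_real.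
have {}D_real i : toC (complex.Re (D 0 i)) = D 0 i by apply: RRe_real.
have PV := invmx_unitary P_unitary.
have [y yE] : exists y, y = map_mx toC u *m invmx P by eexists.
(* [invmx P] is the conjugate transpose of [P], and conjugation fixes the real vector [u]. *)
have yC : y^t* = P *m (map_mx toC u)^T.
  rewrite yE PV trmx_mul map_mxM map_trmx trmxCK; congr (_ *m _).
  by apply/matrixP => i j; rewrite !mxE; apply: conjc_real.
exists (fun i => complex.Re (D 0 i)).
exists (fun i => complex.Re (y 0 i) ^+ 2 + complex.Im (y 0 i) ^+ 2).
have yy i :
    y 0 i * (y 0 i)^* = toC (complex.Re (y 0 i) ^+ 2 + complex.Im (y 0 i) ^+ 2).
  by rewrite [RHS]add_Re2_Im2 sqr_normc.
split=> [i|i||].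
(* Eigenvalues may be tested over [R[i]], where row [i] of [P] is an eigenvector; it is nonzero
   because [P] is invertible. *)
- rewrite -(eigenvalue_map toC) D_real; apply/eigenvalueP.
  exists (row i P).
    rewrite -/AC AC_spec !mulmxA -row_mul mulmxV // -row_mul mul1mx.
    by rewrite row_diag_mx -scalemxAl -rowE.
  apply/eqP => Pi0; have /rowP/(_ i)/eqP := row_mul i P (invmx P).
  by rewrite Pi0 mul0mx mulmxV // !mxE eqxx oner_eq0.
- by rewrite addr_ge0 ?sqr_ge0.
- apply: (@complexI R); rewrite -[LHS]/(toC _) -[RHS]/(toC _) !rmorph_sum /=.
  transitivity ((y *m y^t*) 0 0).
    rewrite yC yE mulmxA mulmxKV // mxE; apply: eq_bigr => i _.
    by rewrite !mxE rmorphXn.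
  by rewrite mxE; apply: eq_bigr => i _; rewrite -yy !mxE.
apply: (@complexI R); rewrite -[LHS]/(toC _) -[RHS]/(toC _) !rmorph_sum /=.
transitivity ((y *m diag_mx D *m y^t*) 0 0).
  rewrite yC yE !mulmxA -(mulmxA _ (invmx P)) -(mulmxA _ (_ *m _) P) -AC_spec.
  by rewrite /AC map_trmx -!map_mxM mxE.
rewrite mxE; apply: eq_bigr => i _.
by rewrite mul_mx_diag !mxE rmorphM /= -yy D_real mulrAC mulrC.
Qed.

Lemma sym_eigenvalue_exists A :
  (0 < n)%N -> A^T = A -> exists a, eigenvalue A a.
Proof.
by move=> n0 /(quad_form_spectral 0)[d [_ [d_eigen _ _ _]]]; exists (d (Ordinal n0)).
Qed.

Lemma quad_form_le_max A u :
  A^T = A -> quad_form A u <= max_eigenvalue A * sqr_norm u.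
Proof.
move=> /(quad_form_spectral u)[d [w [d_eigen w_ge0 -> ->]]].
by rewrite mulr_sumr ler_sum // => i _; rewrite ler_wpM2r ?le_max_eigenvalue.
Qed.

Lemma quad_form_ge_min A u :
  A^T = A -> min_eigenvalue A * sqr_norm u <= quad_form A u.
Proof.
move=> /(quad_form_spectral u)[d [w [d_eigen w_ge0 -> ->]]].
by rewrite mulr_sumr ler_sum // => i _; rewrite ler_wpM2r ?ge_min_eigenvalue.
Qed.

(** For an eigenvector [u] of the largest eigenvalue of [A], the form equals that eigenvalue times
    the squared norm; the form of [B] at [v] is at most its own largest eigenvalue times the same
    norm. Letting [v] depend on [u] allows changes of sign. *)
Lemma max_eigenvalue_mono A B : (0 < n)%N -> A^T = A -> B^T = B ->
    (forall u, exists2 v, sqr_norm v = sqr_norm u &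
                          quad_form A u <= quad_form B v) ->
  max_eigenvalue A <= max_eigenvalue B.
Proof.
move=> n0 A_sym B_sym leAB; have [a a_eigen] := sym_eigenvalue_exists n0 A_sym.
have /eigenvalueP[u uA /sqr_norm_gt0 u_gt0] := eigenvalue_max a_eigen.
have [v v_norm] := leAB u; rewrite (quad_form_eigen uA) => /le_trans.
by move=> /(_ _ (quad_form_le_max v B_sym)); rewrite v_norm ler_pM2r.
Qed.

Lemma min_eigenvalue_ge0 A : (0 < n)%N -> A^T = A ->
  (forall u, 0 <= quad_form A u) -> 0 <= min_eigenvalue A.
Proof.
move=> n0 A_sym A_psd; have [a a_eigen] := sym_eigenvalue_exists n0 A_sym.
have /eigenvalueP[u uA /sqr_norm_gt0 u_gt0] := eigenvalue_min a_eigen.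
by have := A_psd u; rewrite (quad_form_eigen uA) pmulr_lge0.
Qed.

End ExtremalEigenvalues.

(** * Colourings and vertex bipartiteness *)

Section VertexBipartiteness.
Variables (T : finType) (G : sgraph T).

(** The colouring is extended to all of [T], with arbitrary values on [S], to avoid the subtype of
    remaining vertices. *)
Lemma bipartite_delP (S : {set T}) :
  reflect (exists c : pred T, forall x y,
             x \notin S -> y \notin S -> G x y -> c x != c y)
          (bipartite (del_vertices G S)).
Proof.
apply: (iffP existsP) => [[X XP]|[c cP]].
  exists (fun x => if insub x is Some v then v \in X else false).
  move=> x y xS yS Gxy; pose SC z := z \notin S.
  rewrite (insubT SC xS) (insubT SC yS).
  have /forallP/(_ (exist _ y yS))/implyP := forallP XP (exist _ x xS).
  exact.
exists [set v | c (val v)]; apply/forallP => x; apply/forallP => y; apply/implyP.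
by rewrite !inE; apply: cP; [apply: (valP x) | apply: (valP y)].
Qed.

Lemma vertex_bipartitenessP :
  exists2 S : {set T},
    bipartite (del_vertices G S) & #|S| = vertex_bipartiteness G.
Proof.
rewrite /vertex_bipartiteness; case: arg_minnP; first exact: bipartite_del_setT.
by move=> S S_bip _; exists S.
Qed.

Lemma vertex_bipartiteness_le (S : {set T}) :
  bipartite (del_vertices G S) -> (vertex_bipartiteness G <= #|S|)%N.
Proof.
rewrite /vertex_bipartiteness; case: arg_minnP; first exact: bipartite_del_setT.
by move=> ? _; apply.
Qed.

Lemma bipartiteP :
  reflect (exists c : pred T, forall x y, G x y -> c x != c y) (bipartite G).
Proof.
apply: (iffP existsP) => [[X XP]|[c cP]].
  by exists (mem X) => x y; have /forallP/(_ y)/implyP := forallP XP x.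
exists [set x | c x]; apply/forallP => x; apply/forallP => y; apply/implyP.
by rewrite !inE; apply: cP.
Qed.

Lemma vertex_bipartiteness0 : bipartite G -> vertex_bipartiteness G = 0%N.
Proof.
move=> /bipartiteP[c cP]; apply/eqP; rewrite -leqn0 -(cards0 T).
by apply/vertex_bipartiteness_le/bipartite_delP; exists c => x y _ _; apply: cP.
Qed.

(** A single remaining vertex is a bipartite graph. This ensures that the test vector bounding $q_n$
    is nonzero. *)
Lemma vertex_bipartiteness_lt :
  (0 < #|T|)%N -> (vertex_bipartiteness G < #|T|)%N.
Proof.
move=> /card_gt0P[x _]; rewrite -cardsT (cardsD1 x) inE ltnS.
apply/vertex_bipartiteness_le/bipartite_delP; exists xpred0 => y z.
by rewrite !inE !andbT !negbK => /eqP-> /eqP->; rewrite adj_irr.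
Qed.

End VertexBipartiteness.

(** * Both Laplacians as sums over edges, and bounds on their eigenvalues *)

Section SignedLaplacian.
Variables (R : rcfType) (n : nat) (G : sgraph 'I_n).
Implicit Types (e : R) (u : 'rV[R]_n).

Definition signed_laplacian e : 'M[R]_n := degree_mx R G + e *: adjacency_mx R G.

Lemma signless_laplacianE : signless_laplacian R G = signed_laplacian 1.
Proof. by rewrite /signed_laplacian scale1r. Qed.

Lemma laplacianE : laplacian R G = signed_laplacian (-1).
Proof. by rewrite /signed_laplacian scaleN1r. Qed.

Lemma signed_laplacian_sym e : (signed_laplacian e)^T = signed_laplacian e.
Proof.
rewrite linearD linearZ /= tr_diag_mx; congr (_ + _ *: _).
by apply/matrixP => i j; rewrite !mxE adj_sym.
Qed.

(** The form is doubled because the right-hand side runs over ordered pairs and so meets each edge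
    twice. *)
Lemma quad_form_signed_laplacian e u : e ^+ 2 = 1 ->
  quad_form (signed_laplacian e) u *+ 2 =
  \sum_i \sum_j (G i j)%:R * (u 0 i + e * u 0 j) ^+ 2.
Proof.
move=> e1; have qE : quad_form (signed_laplacian e) u =
    \sum_i \sum_j ((G i j)%:R * u 0 i ^+ 2 + (G i j)%:R * (e * u 0 i * u 0 j)).
  rewrite quad_formE; apply: eq_bigr => i _.
  under eq_bigr do rewrite !mxE mulrDl; rewrite !big_split /=; congr (_ + _).
    rewrite (bigD1 i) //= big1 => [|j /negPf]; last first.
      by rewrite eq_sym => ->; rewrite mul0r.
    rewrite eqxx addr0 -mulr_suml /degree -sum1dep_card natr_sum big_mkcond.
    by rewrite expr2; congr (_ * _); apply: eq_bigr => j _; case: (G i j).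
  by apply: eq_bigr => j _; ring.
(* Exchanging the indices in one of the two copies supplies the term in [u 0 j ^+ 2] that completes
   the square. *)
rewrite mulr2n {1}qE qE {1}exchange_big -big_split; apply: eq_bigr => i _.
rewrite -big_split; apply: eq_bigr => j _ /=; rewrite (adj_sym G j i).
by rewrite sqrrD exprMn e1; ring.
Qed.

Lemma signed_laplacian_psd e u :
  e ^+ 2 = 1 -> 0 <= quad_form (signed_laplacian e) u.
Proof.
move=> e1; rewrite -(pmulrn_lge0 _ (ltn0Sn 1)) quad_form_signed_laplacian //.
by do 2!apply: sumr_ge0 => ? _; rewrite mulr_ge0 ?sqr_ge0.
Qed.

Lemma max_laplacian_le_signless : (0 < n)%N ->
  max_eigenvalue (laplacian R G) <= max_eigenvalue (signless_laplacian R G).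
Proof.
move=> n0; rewrite laplacianE signless_laplacianE.
apply: max_eigenvalue_mono; rewrite ?signed_laplacian_sym // => u.
exists (\row_i `|u 0 i|).
  by apply: eq_bigr => i _; rewrite mxE real_normK ?num_real.
rewrite -(ler_pMn2r (ltn0Sn 1)) !quad_form_signed_laplacian ?sqrrN ?expr1n //.
apply: ler_sum => i _; apply: ler_sum => j _; rewrite ler_wpM2l // !mxE.
rewrite mulN1r mul1r -[leLHS]real_normK ?num_real //.
by rewrite ler_pXn2r ?nnegrE ?addr_ge0 // ler_normB.
Qed.

Lemma max_signless_le_laplacian : (0 < n)%N -> bipartite G ->
  max_eigenvalue (signless_laplacian R G) <= max_eigenvalue (laplacian R G).
Proof.
move=> n0 /bipartiteP[c cP]; rewrite laplacianE signless_laplacianE.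
apply: max_eigenvalue_mono; rewrite ?signed_laplacian_sym // => u.
exists (\row_i ((-1) ^+ c i * u 0 i)).
  by apply: eq_bigr => i _; rewrite mxE exprMn sqrr_sign mul1r.
rewrite -(ler_pMn2r (ltn0Sn 1)) !quad_form_signed_laplacian ?sqrrN ?expr1n //.
apply: ler_sum => i _; apply: ler_sum => j _; rewrite !mxE.
(* Adjacent vertices get opposite signs, so the difference of the new entries is, up to sign, the
   sum of the old ones. *)
have [/cP|_] := boolP (G i j); last by rewrite !mul0r.
case: (c i) (c j) => -[] // _;
  by rewrite le_eqVlt; apply/orP; left; apply/eqP; ring.
Qed.

Lemma min_signless_le : (0 < n)%N ->
  min_eigenvalue (signless_laplacian R G) <= (vertex_bipartiteness G)%:R.
Proof.
move=> n0; have [S /bipartite_delP[c cP] S_card] := vertex_bipartitenessP G.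
pose u : 'rV[R]_n := \row_i ((i \notin S)%:R * (-1) ^+ c i).
have u_norm : sqr_norm u = #|~: S|%:R.
  rewrite -sum1_card natr_sum big_mkcond; apply: eq_bigr => i _.
  rewrite mxE exprMn sqrr_sign mulr1 inE.
  by case: ifP => _; rewrite ?expr1n ?expr0n.
have u_gt0 : 0 < sqr_norm u.
  rewrite u_norm ltr0n cardsCs setCK subn_gt0 S_card.
  by rewrite vertex_bipartiteness_lt ?card_ord.
rewrite -(ler_pM2r u_gt0); apply: le_trans.
  by apply: quad_form_ge_min; rewrite signless_laplacianE signed_laplacian_sym.
rewrite signless_laplacianE -(ler_pMn2r (ltn0Sn 1)).
rewrite quad_form_signed_laplacian ?expr1n // u_norm -S_card.
(* Each edge between [S] and its complement contributes 1, and there are at most as many as pairs;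
   [cut] and [cutC] count the two orientations. *)
have cut : \sum_i \sum_j ((i \in S)%:R * (j \in ~: S)%:R : R) =
    #|S|%:R * #|~: S|%:R.
  rewrite -!sum1_card !natr_sum mulr_suml [RHS]big_mkcond; apply: eq_bigr => i _.
  rewrite mulr_sumr; case: ifP => _; last by rewrite big1 // => j _; rewrite mul0r.
  rewrite [RHS]big_mkcond; apply: eq_bigr => j _.
  by rewrite !mul1r; case: ifP.
have cutC : \sum_i \sum_j ((j \in S)%:R * (i \in ~: S)%:R : R) =
    #|S|%:R * #|~: S|%:R.
  by rewrite exchange_big.
rewrite mulr2n -{1}cut -cutC -big_split; apply: ler_sum => i _.
rewrite -big_split; apply: ler_sum => j _ /=; rewrite !mxE !inE mul1r.
(* Inside [S] the entries vanish; for an edge outside [S] they are opposite and cancel, the one case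
   left for [cP]. *)
have [iS|iS] := boolP (i \in S); have [jS|jS] := boolP (j \in S); rewrite /=;
  have [Gij|_] := boolP (G i j); rewrite ?mul0r ?mul1r ?mulr0 ?addr0 ?add0r //=.
all: rewrite ?expr0n ?sqrr_sign ?ler01 //=.
have /negPf cN := cP i j iS jS Gij.
rewrite (_ : c i = ~~ c j) ?signrN ?addNr ?expr0n //.
by case: (c i) (c j) cN => -[].
Qed.

End SignedLaplacian.

Theorem theorem10 (R : rcfType) (n : nat) (G : sgraph 'I_n)
    (G_conn : connected_graph G) (G_noiso : no_isolated_vertex G) :
  signless_spread R G >= laplacian_radius R G - (vertex_bipartiteness G)%:R
  /\ (bipartite G ->
      signless_spread R G = laplacian_radius R G - (vertex_bipartiteness G)%:R).
Proof.
have n0 : (0 < n)%N by have /andP[] := G_conn; rewrite card_ord.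
split=> [|G_bip].
  exact: lerB (max_laplacian_le_signless _ _ _) (min_signless_le _ _ _).
have q1E : max_eigenvalue (signless_laplacian R G) = laplacian_radius R G.
  apply/eqP; rewrite eq_le; apply/andP; split.
    exact: max_signless_le_laplacian.
  exact: max_laplacian_le_signless.
have qnE : min_eigenvalue (signless_laplacian R G) = (vertex_bipartiteness G)%:R.
  apply/eqP; rewrite eq_le; apply/andP; split; first exact: min_signless_le.
  (* The bipartiteness is 0 here, so the remaining bound is positive semidefiniteness. *)
  rewrite vertex_bipartiteness0 // signless_laplacianE.
  apply: min_eigenvalue_ge0 => // [|u]; first exact: signed_laplacian_sym.
  by apply: signed_laplacian_psd; rewrite expr1n.
by rewrite /signless_spread q1E qnE.
Qed.
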